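(* If $G$ is a finite solvable group, then $o(G)\neq\frac{211}{60}$.
   Context: For a finite group $G$, let $o(x)$ denote the order of an element $x\in G$. Let $\psi(G)=\sum_{x\in G}o(x)$ be the sum of element orders of $G$, and let $o(G)=\frac{\psi(G)}{|G|}$ be the average order of $G$ (a rational number). *)

(* Defs.v *)
From mathcomp Require Import all_boot all_order all_algebra all_fingroup all_solvable.
Set Implicit Arguments.
Unset Strict Implicit.
Unset Printing Implicit Defensive.
Import GRing.Theory.
Local Open Scope ring_scope.

Definition sum_orders (gT : finGroupType) (G : {group gT}) : nat :=
  (\sum_(x in G) #[x]%g)%N.

Definition average_order (gT : finGroupType) (G : {group gT}) : rat :=
  (sum_orders G)%:R / #|G|%:R.

(* Main.v *)
(* Pairing x with x^-1 shows that psi(G), the sum of the element orders, is odd, so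
   psi(G)/|G| = 211/60 forces |G| = 60m with m odd and a Sylow 2-subgroup P of order
   4. Let K = O_{2'}(G). For solvable G the quotient G/K is C4, C2 x C2 or A4, and it
   remains to bound the average order on each coset of K in terms of k = |K|.

   For a 2-element x normalising K, the elements of order #[x] in Kx are the
   K-conjugates of x, so there are |K : C_K(x)| of them, and all other elements of Kx
   have order at least 3 #[x].

   If G/K = P has order 4, the average order exceeds 211/60 unless involutions of P
   act on K without fixed points. These invert K, so K is abelian of order divisible
   by 15; then at least 4/5 of K has order at least 5, which is again too much. If G/K
   = A4, some involution t of P (hence every one, by fusion) has |K : C_K(t)| <= k/5,
   and the elements outside KP have order at least 3; this suffices as well. *)
Require Import Defs.
From mathcomp Require Import all_boot all_order all_algebra all_fingroup all_solvable.
From mathcomp Require Import zify.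
Set Implicit Arguments.
Unset Strict Implicit.
Unset Printing Implicit Defensive.
Import GRing.Theory.
Local Open Scope ring_scope.

(** * Element orders and their sums over cosets *)

Section OrderSums.

Local Open Scope nat_scope.
Local Open Scope group_scope.

Variable gT : finGroupType.
Implicit Types (G K P A : {group gT}) (x t u : gT).

(** Parity sees only the elements of odd order. Inversion [s] generates a 2-group acting on them
    with [1] as sole fixed point, so their number is odd. *)
Lemma odd_sum_orders G : odd (sum_orders G).
Proof.
pose A := [set x in G | odd #[x]].
have ->: odd (sum_orders G) = odd #|A|.
  rewrite /sum_orders -sum1_card !(big_morph odd oddD (erefl _)).
  rewrite [RHS](eq_bigl (fun x => (x \in G) && odd #[x])) => [|x]; last by rewrite inE.
  by rewrite big_mkcondr; apply: eq_bigr => x _; case: (odd _).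
pose s := perm (@invg_inj gT).
have s2: s ^+ 2 = 1 by apply/permP=> x; rewrite expgS expg1 permM !permE invgK.
have s_pgroup: 2.-group <[s]>.
  by apply: (@pnat_dvd _ 2) => //; rewrite order_dvdn s2.
have actsA: [acts <[s]>, on A | 'P].
  rewrite cycle_subG; apply/astabsP=> x.
  by rewrite /= apermE permE !inE groupV orderV.
have fixA: 'Fix_(A | 'P)(<[s]>) = [set 1].
  apply/setP=> x; rewrite in_setI afix_cycle // in_set1 [x \in A]inE; apply/idP/eqP=> [|->].
    case/andP=> /andP[_ ox] /afix1P; rewrite /= apermE permE => xV.
    apply/eqP; rewrite -order_eq1; suff: #[x] %| 2.
      by move/dvdn_leq=> /(_ isT); case: #[x] ox => [|[|[]]].
    by rewrite order_dvdn expgS expg1 -{1}xV mulVg.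
  by rewrite group1 order1; apply/afix1P; rewrite /= apermE permE invg1.
have := pgroup_fix_mod s_pgroup actsA; rewrite fixA cards1 !modn2.
by case: (odd _).
Qed.

(** By coprimality the map to cosets of [K] is injective on [<[x]>], while [u] and [x] have the same
    image. *)
Lemma order_rcoset_dvd K x u :
  x \in 'N(K) -> coprime #|K| #[x] -> u \in K :* x -> #[x] %| #[u].
Proof.
move=> nKx coKx Kxu.
have nKu: u \in 'N(K).
  by case/rcosetP: Kxu => k Kk ->; rewrite groupM // (subsetP (normG K)).
have eq_ux: coset K u = coset K x by apply/rcoset_kercosetP.
rewrite order_dvdn -in_set1 -[[set 1]](coprime_TIg coKx) in_setI mem_cycle andbT.
by rewrite coset_idr ?groupX // morphX //= -eq_ux -morphX // expg_order morph1.
Qed.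

Lemma expg_order_rcoset K x u :
  x \in 'N(K) -> u \in K :* x -> u ^+ #[x] \in K.
Proof.
move=> nKx Kxu.
have nKu: u \in 'N(K).
  by case/rcosetP: Kxu => k Kk ->; rewrite groupM // (subsetP (normG K)).
have eq_ux: coset K u = coset K x by apply/rcoset_kercosetP.
by rewrite coset_idr ?groupX // morphX //= eq_ux -morphX // expg_order morph1.
Qed.

(* Schur-Zassenhaus conjugates [<[u]>] to [<[x]>]; a generator in the same coset of
   [K] must then match. *)
Lemma eq_order_rcoset_class K x u :
    solvable K -> x \in 'N(K) -> coprime #|K| #[x] ->
    u \in K :* x -> #[u] = #[x] ->
  u \in x ^: K.
Proof.
move=> solK nKx coKx Kxu ou.
have nKX: <[x]> \subset 'N(K) by rewrite cycle_subG.
have sUKX: <[u]> \subset K * <[x]>.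
  rewrite -norm_joinEr // cycle_subG /= norm_joinEr //.
  by case/rcosetP: Kxu => k Kk ->; rewrite mem_mulg ?cycle_id.
have [h Kh defU] := SchurZassenhaus_trans_sol solK nKX sUKX coKx ou.
apply/imsetP; exists h => //; apply/eqP.
have Ux: x ^ h \in <[u]> by rewrite defU memJ_conjg cycle_id.
have coKu: coprime #|K| #[u] by rewrite ou.
rewrite eq_mulgV1 -in_set1 -[[set 1]](coprime_TIg coKu) in_setI.
rewrite [X in _ && X]groupM ?cycle_id ?groupV // andbT -mem_rcoset.
suff /rcoset_eqP <-: x \in K :* (x ^ h) by [].
have Kxh: x * (x ^ h)^-1 = h^-1 ^ x^-1 * h by rewrite !conjgE !invMg !invgK !mulgA.
by rewrite mem_rcoset Kxh groupM // memJ_norm ?groupV.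
Qed.

Definition rcoset_orders K x : nat := \sum_(u in K :* x) #[u].

Lemma rcoset_orders1 K : rcoset_orders K 1 = sum_orders K.
Proof. by rewrite /rcoset_orders rcoset1. Qed.

Lemma leq_rcoset_orders K x :
    odd #|K| -> solvable K -> x \in 'N(K) -> coprime #|K| #[x] ->
  (3 * #[x] * #|K| <=
     rcoset_orders K x + 2 * #[x] * #|K : 'C_K[x]|)%N.
Proof.
move=> oddK solK nKx coKx; rewrite index_cent1.
(* Adding [2 * #[x]] on the class lifts its elements from order [#[x]] to the value [3 * #[x]] that
   every other element of the coset already reaches. *)
apply: (@leq_trans (\sum_(u in K :* x) (#[u] + 2 * #[x] * (u \in x ^: K)))).
  rewrite -(card_rcoset K x) mulnC -sum_nat_const.
  apply: leq_sum => u Kxu; have [ou|ou] := eqVneq #[u] #[x].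
    by rewrite eq_order_rcoset_class // ou; lia.
  have dvd_ux := order_rcoset_dvd nKx coKx Kxu.
  have oux := orderXdiv dvd_ux.
  (* The quotient is the order of [u ^+ #[x]], an element of [K]; being odd and not 1, it is at
     least 3. *)
  have odd_ux: odd (#[u] %/ #[x]).
    rewrite -oux; apply: dvdn_odd oddK; apply: order_dvdG.
    exact: expg_order_rcoset.
  move: ou odd_ux; rewrite -{1 3}(divnK dvd_ux).
  case: (_ %/ _) => [|[|[|n]]] //; last by lia.
  by rewrite mul1n eqxx.
rewrite big_split leq_add2l -big_distrr leq_mul2l; apply/orP; right.
rewrite -sum1_card big_mkcond [X in _ <= X]big_mkcond /=; apply: leq_sum => u _.
by case: (_ \in _).
Qed.

Lemma leq_sum_orders K : odd #|K| -> solvable K -> (3 * #|K| <= sum_orders K + 2)%N.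
Proof.
move=> oddK solK; have := leq_rcoset_orders oddK solK (group1 _).
rewrite rcoset_orders1 order1 coprimen1 index_cent1 class1G cards1.
by apply.
Qed.

(** The map sending [y] to [y ^ t * y^-1] is injective on [K] because [t] fixes only [1], hence onto
    by finiteness, and [t] inverts each of its values. *)
Lemma fixfree_involution_inv K t :
  t \in 'N(K) -> t ^+ 2 = 1 -> 'C_K[t] = 1 -> {in K, forall y, y ^ t = y^-1}.
Proof.
move=> nKt t2 regKt.
pose f y := y ^ t * y^-1.
have inj_f: {in K &, injective f}.
  move=> y z Ky Kz eq_f; apply/eqP; rewrite eq_mulVg1 -in_set1.
  rewrite -[[set 1]]regKt inE groupM ?groupV //=; apply/cent1P/commgP/conjg_fixP.
  have zJ: z ^ t = f y * z by rewrite eq_f mulgKV.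
  by rewrite conjMg conjVg zJ /f -mulgA mulKg.
have imf: f @: K = K.
  apply/eqP; rewrite eqEcard card_in_imset // leqnn andbT.
  by apply/subsetP=> _ /imsetP[y Ky ->]; rewrite groupM ?groupV ?memJ_norm.
move=> y; rewrite -{1}imf => /imsetP[z _ ->].
by rewrite /f conjMg conjVg -conjgM -[t * t]/(t ^+ 2) t2 conjg1 [RHS]invMg invgK.
Qed.

Lemma inv_conj_abelian K t : {in K, forall y, y ^ t = y^-1} -> abelian K.
Proof.
move=> invK; apply/centsP=> y Ky z Kz; apply: invg_inj.
by rewrite -invK ?groupM // conjMg !invK // -invMg.
Qed.

Lemma cent_mul_inv_conj K s t :
    {in K, forall y, y ^ s = y^-1} -> {in K, forall y, y ^ t = y^-1} ->
  s * t \in 'C(K).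
Proof.
move=> invs invt; apply/centP=> y Ky; apply/commute_sym/commgP/conjg_fixP.
by rewrite conjgM invs // conjVg invt // invgK.
Qed.

(** Elements outside the Sylow 3-subgroup [S] have odd order other than 1 and 3, so at least 5. As 5
    divides [#|K|], [S] is at most a fifth of [K], which gives 1/5 + 5 * 4/5 = 21/5. *)
Lemma sum_orders_abelian K :
  abelian K -> odd #|K| -> 5 %| #|K| -> (21 * #|K| <= 5 * sum_orders K)%N.
Proof.
move=> abK oddK K5; set S := 'O_3(K).
have hallS: 3.-Sylow(K) S by apply/nilpotent_pcore_Hall/abelian_nil.
have sSK: S \subset K := pcore_sub _ _.
have cardS: (5 * #|S| <= #|K|)%N.
  rewrite -(Lagrange sSK) mulnC leq_mul2l; apply/orP; right; apply: dvdn_leq => //.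
  rewrite -(@Gauss_dvdr 5 #|S|) ?Lagrange //.
  rewrite coprime_sym; apply: (@pnat_coprime 3); first exact: pcore_pgroup.
  by [].
have ord5: {in K, forall x, x \notin S -> 5 <= #[x]}%N.
  move=> x Kx; rewrite (mem_normal_Hall hallS (pcore_normal _ _) Kx) => not3x.
  have oddx: odd #[x] := dvdn_odd (order_dvdG Kx) oddK.
  move: not3x oddx; rewrite /p_elt.
  by case: #[x] (order_gt0 x) => [|[|[|[|[|n]]]]].
rewrite /sum_orders (big_setID S) /= (setIidPr sSK).
have le1: (#|S| <= \sum_(x in S) #[x])%N.
  by rewrite -sum1_card; apply: leq_sum => x _; apply: order_gt0.
have le5: (#|K :\: S| * 5 <= \sum_(x in K :\: S) #[x])%N.
  by rewrite -sum_nat_const; apply: leq_sum => x /setDP[Kx Sx]; apply: ord5.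
apply: leq_trans (leq_mul (leqnn 5) (leq_add le1 le5)).
rewrite cardsD (setIidPr sSK).
set s := #|S| in cardS *; set k := #|K| in cardS *; lia.
Qed.

Lemma sum_mulg_TI K P (F : gT -> nat) :
    K :&: P = 1 ->
  \sum_(u in K * P) F u = \sum_(p in P) \sum_(u in K :* p) F u.
Proof.
move=> tiKP; rewrite (set_partition_big _ (rcosets_partition_mul P K)) /=.
rewrite big_imset /= => [|p q Pp Pq]; first by apply: eq_bigr => p; rewrite rcosetE.
rewrite !rcosetE => /rcoset_eqP; rewrite mem_rcoset => Kpq.
by apply/eqP; rewrite eq_mulgV1 -in_set1 -[[set 1]]tiKP inE Kpq groupM ?groupV.
Qed.

Lemma big_four P a b c (F : gT -> nat) :
    #|P| = 4 -> uniq [:: 1; a; b; c] -> a \in P -> b \in P -> c \in P ->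
  \sum_(p in P) F p = (F 1%g + F a + F b + F c)%N.
Proof.
move=> cardP uniq4 Pa Pb Pc.
have eqP4: P =i [:: 1; a; b; c].
  apply: fsym; apply/subset_cardP; last first.
    by apply/subsetP=> p; rewrite !inE => /or4P[] /eqP->.
  by rewrite cardP; apply/card_uniqP.
by rewrite (eq_bigl _ _ eqP4) -big_uniq //= !big_cons big_nil addn0 !addnA.
Qed.

End OrderSums.

(** * Solvable groups with trivial odd core and a Sylow 2-subgroup of order 4 *)

Section OddIndexOrder4.

Local Open Scope nat_scope.
Local Open Scope group_scope.

Variable gT : finGroupType.
Implicit Types (G H L P Q : {group gT}) (s t : gT).

(* Descending along the derived series of [C = 'C_H('F(H))]: if [C^`(n.+1)] lies in
   ['F(H)], it is central in [C^`(n)], which is then nilpotent and normal in [H]. *)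
Lemma solvable_cent_sub_Fitting H : solvable H -> 'C_H('F(H)) \subset 'F(H).
Proof.
move=> solH; pose C := 'C_H('F(H))%G.
have nsCH: C <| H by apply: norm_normalI; apply/norms_cent/gFnorm.
have cCF: 'F(H) \subset 'C(C) by rewrite centsC subsetIr.
have step n: C^`(n.+1) \subset 'F(H) -> C^`(n) \subset 'F(H).
  move=> sCF; apply: Fitting_max; first exact: char_normal_trans (der_char n C) nsCH.
  rewrite -quotient_center_nil abelian_nil // sub_der1_abelian //.
  rewrite subsetI der1_subG /=; apply: subset_trans sCF _.
  by apply: subset_trans cCF _; rewrite centS // der_sub.
have /derivedP[n]: solvable C by apply: solvableS solH; apply: normal_sub.
move=> Cn1; have: C^`(n) \subset 'F(H) by rewrite Cn1 sub1G.
by elim: n {Cn1} => [|n IHn] // /step/IHn.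
Qed.

(** With trivial odd core the Fitting subgroup is ['O_2(H)], which contains its own centraliser.
    Were its order at most 2, it would be central, forcing [H] into it against [#|Q| = 4]. *)
Lemma normal_self_cent_Sylow2 H Q :
    solvable H -> 'O_2^'(H) = 1 -> 2.-Sylow(H) Q -> #|Q| = 4 ->
  Q <| H /\ 'C_H(Q) \subset Q.
Proof.
move=> solH core1 sylQ cardQ.
have := solvable_cent_sub_Fitting solH; rewrite (Fitting_eq_pcore core1) => cFF.
have sFQ: 'O_2(H) \subset Q := pcore_sub_Hall sylQ.
have nsFH: 'O_2(H) <| H := pcore_normal _ _.
suff defF: 'O_2(H) = Q by rewrite -defF.
apply/eqP; rewrite eqEcard sFQ cardQ leqNgt; apply/negP=> ltF4.
have leF2: #|'O_2(H)| <= 2.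
  have := cardSg sFQ; rewrite cardQ; case: #|_| ltF4 => [|[|[|[|]]]] //.
suff: H \subset 'O_2(H).
  move=> sHF; have := subset_leq_card (subset_trans (pHall_sub sylQ) sHF).
  by rewrite cardQ leqNgt ltF4.
apply: subset_trans cFF; rewrite subsetI subxx centsC.
apply/centsP=> x Fx g Hg; apply/commgP/conjg_fixP.
have [->|x1] := eqVneq x 1; first exact: conj1g.
have Fxg: x ^ g \in 'O_2(H) by rewrite memJ_norm // (subsetP (normal_norm nsFH)).
apply/(@card_le1_eqP _ ('O_2(H)^#)); rewrite ?inE ?conjg_eq1 ?x1 ?Fx ?Fxg //.
by move: leF2; rewrite (cardsD1 1) group1.
Qed.

(** Elements of the abelian group [Q] have classes of odd size, since [Q] centralises them and has
    odd index. A noncentral one therefore has all three elements of [Q^#] as its class; its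
    centraliser is [Q], so [H] has order 4 * 3. *)
Lemma fusion_order4 H Q :
    Q <| H -> 'C_H(Q) \subset Q -> #|Q| = 4 -> odd #|H : Q| -> ~~ (H \subset Q) ->
  #|H| = 12 /\ {in Q^# &, forall s t, s \in t ^: H}.
Proof.
move=> nsQH cQQ cardQ oddHQ not_sHQ; have [sQH nQH] := andP nsQH.
have abQ: abelian Q by apply: (@card_p2group_abelian _ 2).
have odd_class L s: Q \subset L -> L \subset H -> s \in Q -> odd #|s ^: L|.
  move=> sQL sLH Qs; rewrite -index_cent1; apply: dvdn_odd oddHQ.
  apply: dvdn_trans (indexSg sQL sLH); apply: indexgS.
  by rewrite subsetI sQL sub_cent1 (subsetP abQ).
have cardQ1: #|Q^#| = 3 by apply/succn_inj; rewrite -cardQ (cardsD1 1 Q) group1.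
have class_sub L s: L \subset H -> s \in Q^# -> s ^: L \subset Q^#.
  move=> sLH /setD1P[s1 Qs]; apply/subsetP=> _ /imsetP[g Lg ->].
  by rewrite !inE conjg_eq1 s1 memJ_norm // (subsetP nQH) // (subsetP sLH).
have [t Qt not_cHt]: exists2 t, t \in Q & ~~ (H \subset 'C[t]).
  apply/exists_inP; rewrite -negb_forall_in; apply: contra not_sHQ => /forall_inP cHQ.
  apply: subset_trans cQQ; rewrite subsetI subxx; apply/centsP=> h Hh q Qq.
  by apply/cent1P; apply: (subsetP (cHQ q Qq)).
have t1: t != 1 by apply: contraNneq not_cHt => ->; rewrite cent11T subsetT.
have Qt1: t \in Q^# by rewrite !inE t1.
have defQ1: t ^: H = Q^#.
  apply/eqP; rewrite eqEcard class_sub // cardQ1.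
  have := odd_class H t sQH (subxx H) Qt.
  have: #|t ^: H| != 1%N.
    apply: contra not_cHt => /cards1P[s defs].
    apply/subsetP=> h Hh; apply/cent1P/commute_sym/commgP/conjg_fixP.
    have := memJ_class t Hh; have := class_refl H t.
    by rewrite defs !inE => /eqP-> /eqP.
  by case: #|_| => [|[|[|]]].
split; last first.
  move=> r s; rewrite -defQ1 => Hr Hs.
  by rewrite (class_eqP Hs).
(* For [s] in [Q^#] other than [t], the class of [s] under ['C_H[t]] avoids [t], so it has at most
   two elements, hence one by parity. Thus ['C_H[t]] centralises [Q]. *)
have defC: 'C_H[t] = Q.
  have sQC: Q \subset 'C_H[t] by rewrite subsetI sQH sub_cent1 (subsetP abQ).
  apply/eqP; rewrite eqEsubset sQC andbT; apply: subset_trans cQQ.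
  rewrite subsetI subsetIl centsC; apply/subsetP=> s Qs; rewrite -sub_cent1.
  have [->|s1] := eqVneq s 1; first by rewrite cent11T subsetT.
  have [->|st] := eqVneq s t; first exact: subsetIr.
  have Qs1: s \in Q^# by rewrite !inE s1.
  have lt2: #|s ^: 'C_H[t]| <= 2.
    have <-: #|Q^# :\ t| = 2 by apply/succn_inj; rewrite -cardQ1 (cardsD1 t Q^#) Qt1.
    apply: subset_leq_card; rewrite subsetD1 class_sub ?subsetIl //=.
    apply: contra st => /imsetP[h Ch ts]; apply/eqP; apply: (conjg_inj h).
    rewrite -ts; apply/esym/conjg_fixP/commgP/esym/cent1P.
    by case/setIP: Ch.
  have /cards1P[r defr]: #|s ^: 'C_H[t]| == 1%N.
    by have := odd_class _ s sQC (subsetIl _ _) Qs; case: #|_| lt2 => [|[|[|]]].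
  apply/subsetP=> h Ch; apply/cent1P/commute_sym/commgP/conjg_fixP.
  have := memJ_class s Ch; have := class_refl 'C_H[t] s.
  by rewrite defr !inE => /eqP-> /eqP.
by rewrite -(Lagrange sQH) cardQ -defC index_cent1 defQ1 cardQ1.
Qed.

End OddIndexOrder4.

(** * Structure of a solvable group modulo its odd core *)

Section NormalTwoComplement.

Local Open Scope nat_scope.
Local Open Scope group_scope.

Variable gT : finGroupType.
Implicit Types (G K P : {group gT}) (a b s t x : gT).

Lemma order4_Sylow_structure G P :
    solvable G -> 2.-Sylow(G) P -> #|P| = 4 ->
  'O_2^'(G) * P = G \/
  [/\ 'O_2^'(G) * P \subset G, #|G| = (12 * #|'O_2^'(G)|)%N,
      {in G :\: 'O_2^'(G) * P, forall x, 2 < #[x]} &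
      {in P^# &, forall s t, exists2 g, g \in G & s ^ g \in 'O_2^'(G) :* t}].
Proof.
move=> solG sylP cardP; set K := 'O_2^'(G)%G.
have nsKG: K <| G := pcore_normal _ _.
have [sKG nKG] := andP nsKG; have sPG := pHall_sub sylP.
have nKP: P \subset 'N(K) := subset_trans sPG nKG.
have tiKP: K :&: P = 1.
  apply: coprime_TIg; rewrite coprime_sym.
  exact: pnat_coprime (pHall_pgroup sylP) (pcore_pgroup _ _).
have sylPb: 2.-Sylow(G / K) (P / K) by apply: quotient_pHall.
have cardPb: #|P / K| = 4 by rewrite -(card_isog (quotient_isog nKP tiKP)).
have [nsPb cPb] := normal_self_cent_Sylow2 (quotient_sol K solG)
  (trivg_pcore_quotient _ _) sylPb cardPb.
have sKPG: K * P \subset G by rewrite mul_subG.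
have [sGP|not_sGP] := boolP (G / K \subset P / K); [left | right].
  by apply/eqP; rewrite eqEsubset sKPG -quotientSK.
have odd_index: odd #|G / K : P / K|.
  have [_ _] := and3P sylPb.
  by rewrite p'natE // dvdn2 negbK.
have [cardGb fusion] := fusion_order4 nsPb cPb cardPb odd_index not_sGP.
split=> //.
- by rewrite -(Lagrange sKG) mulnC -card_quotient // cardGb.
(* An element of order at most 2 maps to a 2-element of [G / K], hence into the normal Sylow
   subgroup [P / K]. *)
- move=> x /setDP[Gx KPx]; rewrite ltnNge; apply: contra KPx => le2.
  have nKx := subsetP nKG x Gx.
  have: coset K x \in P / K.
    rewrite (mem_normal_Hall sylPb nsPb) ?mem_quotient //.
    apply: (pnat_dvd (morph_order _ nKx)).
    by case: #[x] (order_gt0 x) le2 => [|[|[|]]].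
  case/morphimP=> y nKy Py /= eq_xy.
  have: x \in K :* y by apply/rcoset_kercosetP.
  by case/rcosetP=> k Kk ->; apply: mem_mulg.
move=> s t /setD1P[s1 Ps] /setD1P[t1 Pt].
have nKs := subsetP nKP s Ps; have nKt := subsetP nKP t Pt.
have Pb1 p: p != 1 -> p \in P -> coset K p \in (P / K)^#.
  move=> p1 Pp; rewrite !inE mem_quotient // andbT.
  apply: contraNneq p1 => /(coset_idr (subsetP nKP p Pp)) Kp.
  by rewrite -in_set1 -[[set 1]]tiKP inE Kp.
have /imsetP[_ /morphimP[g nKg Gg ->] eq_ts] :=
  fusion _ _ (Pb1 t t1 Pt) (Pb1 s s1 Ps).
exists g => //; apply/rcoset_kercosetP; rewrite ?groupJ //.
by rewrite morphJ.
Qed.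

(** * Lower bounds for the sum of element orders over [K * P], with [k = #|K|] *)

Lemma cent1_fixfree_or_index K x :
  odd #|K| -> 'C_K[x] = 1 \/ 3 * #|K : 'C_K[x]| <= #|K|.
Proof.
move=> oddK; have [|nt] := eqVneq 'C_K[x] 1; [by left | right].
have sCK: 'C_K[x] \subset K := subsetIl _ _.
rewrite -(Lagrange sCK) leq_mul2r; apply/orP; right.
have := dvdn_odd (cardSg sCK) oddK; rewrite -cardG_gt1 in nt.
by case: #|_| nt => [|[|[|]]].
Qed.

Lemma index_cent1_le K x : #|K : 'C_K[x]| <= #|K|.
Proof. exact: dvdn_leq (cardG_gt0 K) (dvdn_indexg _ _). Qed.

Lemma rcoset_orders_cent K t :
    odd #|K| -> #[t] = 2 -> t \in 'C(K) ->
  rcoset_orders K t = (2 * sum_orders K)%N.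
Proof.
move=> oddK ot cKt; rewrite /rcoset_orders /sum_orders big_distrr /=.
rewrite -rcosetE /rcoset big_imset /= => [|x y _ _]; last exact: mulIg.
apply: eq_bigr => x Kx; rewrite orderM ?ot 1?mulnC //.
  by apply/commute_sym; apply: (centP cKt).
by rewrite coprimen2; apply: dvdn_odd (order_dvdG Kx) oddK.
Qed.

(** Both [a] and [b] invert [K], so [K] is abelian and [a * b] centralises it. The cosets of [1] and
    [a * b] give at least 21k/5 and 42k/5, the other two at least 2k each, and 15 * (63/5 + 4) =
    249. *)
Lemma sum_orders_coset_involutions K a b :
    odd #|K| -> solvable K -> a \in 'N(K) -> b \in 'N(K) ->
    #[a] = 2 -> #[b] = 2 -> #[a * b] = 2 -> 15 %| #|K| ->
    'C_K[a] = 1 -> 'C_K[b] = 1 ->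
  211 * #|K| < 15 * (sum_orders K + rcoset_orders K a + rcoset_orders K b
                     + rcoset_orders K (a * b)).
Proof.
move=> oddK solK nKa nKb oa ob oab K15 regKa regKb.
have coK2: coprime #|K| 2 by rewrite coprimen2.
have a2: a ^+ 2 = 1 by rewrite -oa expg_order.
have b2: b ^+ 2 = 1 by rewrite -ob expg_order.
have inva := fixfree_involution_inv nKa a2 regKa.
have invb := fixfree_involution_inv nKb b2 regKb.
rewrite (rcoset_orders_cent oddK oab) ?cent_mul_inv_conj //.
have K5: 5 %| #|K| by apply: dvdn_trans K15.
have := sum_orders_abelian (inv_conj_abelian inva) oddK K5.
have := leq_rcoset_orders oddK solK nKa; have := leq_rcoset_orders oddK solK nKb.
rewrite oa ob => /(_ coK2) leb /(_ coK2) lea.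
have := index_cent1_le K a; have := index_cent1_le K b.
have := cardG_gt0 K; lia.
Qed.

Lemma sum_mulg_order4 K P a b :
    K :&: P = 1 -> #|P| = 4 -> a \in P -> b \in P -> uniq [:: 1; a; b; a * b] ->
  \sum_(u in K * P) #[u] =
    (sum_orders K + rcoset_orders K a + rcoset_orders K b
     + rcoset_orders K (a * b)%g)%N.
Proof.
move=> tiKP cardP Pa Pb uniq4; rewrite (sum_mulg_TI _ tiKP).
by rewrite (big_four _ cardP uniq4) ?groupM // -[sum_orders K]rcoset_orders1.
Qed.

(** The constants express 211/60 for a group of order 4k, as 4 * 211/60 = 211/15. The two cosets of
    elements of order 4 give at least 4k each. *)
Lemma sum_orders_cyclic4 K P :
    odd #|K| -> solvable K -> P \subset 'N(K) -> cyclic P -> #|P| = 4 ->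
    15 %| #|K| ->
  211 * #|K| < 15 * \sum_(u in (K * P)%g) #[u].
Proof.
move=> oddK solK nKP /cyclicP[x defP] cardP K15.
have ox: #[x] = 4 by rewrite orderE -defP.
have Px: x \in P by rewrite defP cycle_id.
have nKx := subsetP nKP x Px.
have ox2: #[x ^+ 2] = 2 by rewrite orderXdiv ox.
have ox3: #[x * x ^+ 2] = 4 by rewrite -expgS orderXgcd ox.
have coK m: m \in 2.-nat -> coprime #|K| m.
  rewrite coprime_sym => m2; apply: pnat_coprime m2 _.
  by rewrite p'natE // dvdn2 oddK.
have tiKP: K :&: P = 1 by rewrite coprime_TIg // cardP coK.
have uniq4: uniq [:: 1; x; x ^+ 2; x * x ^+ 2].
  rewrite -expgS; change (uniq [seq x ^+ i | i <- iota 0 4]).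
  rewrite map_inj_in_uniq ?iota_uniq // => i j; rewrite !mem_iota => lti ltj /eqP.
  by rewrite eq_expg_mod_order ox !modn_small // => /eqP.
rewrite (sum_mulg_order4 tiKP cardP _ _ uniq4) ?groupX //.
have k15: 15 <= #|K| by apply: dvdn_leq K15.
have := leq_rcoset_orders oddK solK nKx.
have := leq_rcoset_orders oddK solK (groupX 2 nKx).
have := leq_rcoset_orders oddK solK (groupM nKx (groupX 2 nKx)).
rewrite ox ox2 ox3 !coK //.
move=> /(_ (erefl _)) le3 /(_ (erefl _)) le2 /(_ (erefl _)) le1.
have := index_cent1_le K x; have := index_cent1_le K (x * x ^+ 2).
have := leq_sum_orders oddK solK; have := index_cent1_le K (x ^+ 2).
(* If [x ^+ 2] has a nontrivial fixed point, the total is at least 47k/3 - 2. Otherwise it inverts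
   [K], and the abelian bound gives 8k + 2k + 21k/5 = 213k/15. *)
have [regK|] := cent1_fixfree_or_index (x ^+ 2) oddK; last lia.
have K5: 5 %| #|K| by apply: dvdn_trans K15.
have x4: (x ^+ 2) ^+ 2 = 1 by apply/eqP; rewrite -order_dvdn ox2.
have abK := inv_conj_abelian (fixfree_involution_inv (groupX 2 nKx) x4 regK).
have := sum_orders_abelian abK oddK K5; lia.
Qed.

Lemma noncyclic4_involution P t :
  #|P| = 4 -> ~~ cyclic P -> t \in P^# -> #[t] = 2.
Proof.
move=> cardP ncP /setD1P[t1 Pt].
have := order_dvdG Pt; rewrite cardP.
have: #[t] != 4.
  apply: contra ncP => /eqP ot; apply/cyclicP; exists t; apply/eqP.
  by rewrite eq_sym eqEcard cycle_subG Pt cardP -orderE ot.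
have: #[t] != 1%N by rewrite order_eq1.
by case: #[t] => [|[|[|[|[|n]]]]] // _ _ /dvdn_leq => /(_ isT).
Qed.

Lemma noncyclic4_generators P :
    #|P| = 4 -> ~~ cyclic P ->
  exists a b, [/\ a \in P^#, b \in P^#, a * b \in P^# & uniq [:: 1; a; b; a * b]].
Proof.
move=> cardP ncP.
have cardP1: #|P^#| = 3 by apply/succn_inj; rewrite -cardP (cardsD1 1 P) group1.
have /card_gt0P[a Pa]: 0 < #|P^#| by rewrite cardP1.
have /card_gt0P[b]: 0 < #|P^# :\ a|.
  by move: cardP1; rewrite (cardsD1 a) Pa add1n => -[->].
case/setD1P=> ba Pb; exists a, b.
have oa := noncyclic4_involution cardP ncP Pa.
have ab1: a * b != 1.
  apply: contra ba => /eqP ab1; apply/eqP/(mulgI a).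
  by rewrite ab1 -[a * a]/(a ^+ 2) -oa expg_order.
case/setD1P: Pa Pb => a1 Pa /setD1P[b1 Pb]; rewrite !inE a1 b1 ab1 groupM //.
split=> //=; rewrite !inE !negb_or !(eq_sym 1) a1 b1 ab1 eq_sym ba /=.
by rewrite (eq_mulVg1 a) mulKg (eq_sym b (a * b)) (eq_mulgV1 (a * b)) mulgK a1 b1.
Qed.

Lemma sum_orders_noncyclic4 K P :
    odd #|K| -> solvable K -> P \subset 'N(K) -> ~~ cyclic P -> #|P| = 4 ->
    15 %| #|K| ->
  211 * #|K| < 15 * \sum_(u in (K * P)%g) #[u].
Proof.
move=> oddK solK nKP ncP cardP K15.
have coK2: coprime #|K| 2 by rewrite coprimen2.
have tiKP: K :&: P = 1 by rewrite coprime_TIg // cardP; apply: (@coprimeXr 2 _ 2).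
have [a [b [Pa Pb Pab uniq4]]] := noncyclic4_generators cardP ncP.
have oP t := @noncyclic4_involution P t cardP ncP.
have nK t: t \in P^# -> t \in 'N(K) by case/setD1P=> _ /(subsetP nKP).
have P2 t: t \in P^# -> t * t = 1.
  by move=> Pt; rewrite -[t * t]/(t ^+ 2) -(oP t Pt) expg_order.
have inP t: t \in P^# -> t \in P by case/setD1P.
rewrite (sum_mulg_order4 tiKP cardP _ _ uniq4) ?inP //.
have k15: 15 <= #|K| by apply: dvdn_leq K15.
have le t: t \in P^# -> 6 * #|K| <= rcoset_orders K t + 4 * #|K : 'C_K[t]|.
  by move=> Pt; have := leq_rcoset_orders oddK solK (nK t Pt); rewrite oP //; apply.
have key s t: s \in P^# -> t \in P^# -> s * t \in P^# ->
    'C_K[s] = 1 -> 'C_K[t] = 1 ->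
  211 * #|K| < 15 * (sum_orders K + rcoset_orders K s + rcoset_orders K t
                     + rcoset_orders K (s * t)).
  by move=> Ps Pt Pst; apply: sum_orders_coset_involutions; rewrite ?nK ?oP.
have := leq_sum_orders oddK solK; move: (le a Pa) (le b Pb) (le _ Pab).
have abP: abelian P by apply: (@card_p2group_abelian _ 2).
have ab_ba: a * b = b * a by apply: (centsP abP); apply: inP.
have b_ab: b * (a * b) = a by rewrite ab_ba mulgA P2 ?mul1g.
have a_ab: a * (a * b) = b by rewrite mulgA P2 ?mul1g.
have := index_cent1_le K a; have := index_cent1_le K b; have := index_cent1_le K (a * b).
(* An involution with a nontrivial fixed point contributes at least 14k/3, any other at least 2k.
   Two of the former suffice as [15 <= #|K|]; otherwise two are fixed-point-free and [key] applies,
   the third being their product. *)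
have [rega|] := cent1_fixfree_or_index a oddK;
have [regb|] := cent1_fixfree_or_index b oddK;
have [regab|] := cent1_fixfree_or_index (a * b) oddK; try lia.
- by have := key a b Pa Pb Pab rega regb; lia.
- by have := key a b Pa Pb Pab rega regb; lia.
- by have := key a (a * b) Pa Pab; rewrite a_ab => /(_ Pb rega regab); lia.
- by have := key b (a * b) Pb Pab; rewrite b_ab => /(_ Pa regb regab); lia.
Qed.

(* An involution acting on an odd-order group without fixed points inverts it, so the
   product of two such involutions centralises it; hence the four-group [P] cannot act
   on its invariant Sylow 5-subgroup of [K] with all its involutions fixed-point-free. *)
Lemma noncyclic4_fixed5 K P :
    odd #|K| -> P \subset 'N(K) -> ~~ cyclic P -> #|P| = 4 -> 5 %| #|K| ->
  exists2 t, t \in P^# & 5 * #|K : 'C_K[t]| <= #|K|.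
Proof.
move=> oddK nKP ncP cardP K5.
have [a [b [Pa Pb Pab _]]] := noncyclic4_generators cardP ncP.
have abP: abelian P by apply: (@card_p2group_abelian _ 2).
have coKP: coprime #|K| #|P| by rewrite cardP; apply: (@coprimeXr 2 _ 2); rewrite coprimen2.
have [Q sylQ nQP] := sol_coprime_Sylow_exists 5 (abelian_sol abP) nKP coKP.
have sQK := pHall_sub sylQ.
have ntQ: Q :!=: 1.
  rewrite -rank_gt0 (rank_Sylow sylQ) p_rank_gt0.
  by rewrite mem_primes /= cardG_gt0.
have P2 t: t \in P^# -> t ^+ 2 = 1.
  by move=> Pt; rewrite -(noncyclic4_involution cardP ncP Pt) expg_order.
have nQ t: t \in P^# -> t \in 'N(Q) by case/setD1P=> _ /(subsetP nQP).
have [t Pt ntC]: exists2 t, t \in P^# & 'C_Q[t] != 1.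
  have [rega|] := eqVneq 'C_Q[a] 1; last by exists a.
  have [regb|] := eqVneq 'C_Q[b] 1; last by exists b.
  exists (a * b) => //; suff /setIidPl->: Q \subset 'C[a * b] by [].
  rewrite sub_cent1; apply: cent_mul_inv_conj;
  by apply: fixfree_involution_inv; rewrite ?nQ ?P2.
exists t => //; have sCC: 'C_Q[t] \subset 'C_K[t] by rewrite setSI.
have sCK: 'C_K[t] \subset K := subsetIl _ _.
rewrite -[X in _ <= X](Lagrange sCK) leq_mul2r; apply/orP; right.
apply: dvdn_leq (cardG_gt0 _) _; apply: dvdn_trans (cardSg sCC).
have pC: 5.-group 'C_Q[t] by apply: pgroupS (subsetIl _ _) (pHall_pgroup sylQ).
by have [_ ->] := pgroup_pdiv pC ntC.
Qed.

Lemma card_class_norm K s g : g \in 'N(K) -> #|(s ^ g) ^: K| = #|s ^: K|.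
Proof.
by move=> nKg; rewrite -class_lcoset -norm_rlcoset // class_rcoset cardJg.
Qed.

(** The constant is what a group of order 12k needs once the 8k elements outside [K * P] contribute
    3 each: 12 * 211/60 - 24 = 91/5. *)
Lemma sum_orders_fused4 K P :
    odd #|K| -> solvable K -> P \subset 'N(K) -> #|P| = 4 ->
    5 %| #|K| ->
    {in P^# &, forall s t, exists2 g, g \in 'N(K) & s ^ g \in K :* t} ->
  91 * #|K| < 5 * \sum_(u in (K * P)%g) #[u].
Proof.
move=> oddK solK nKP cardP K5 fusP.
have coK2: coprime #|K| 2 by rewrite coprimen2.
have tiKP: K :&: P = 1 by rewrite coprime_TIg // cardP; apply: (@coprimeXr 2 _ 2).
(* In a cyclic [P], fusion would put a conjugate of a generator [x] into the coset of [x ^+ 2]; its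
   square would be an involution in the odd-order group [K]. *)
have ncP: ~~ cyclic P.
  apply/negP=> /cyclicP[x defP]; have ox: #[x] = 4 by rewrite orderE -defP.
  have ox2: #[x ^+ 2] = 2 by rewrite orderXdiv ox.
  have Px: x \in P^# by rewrite !inE defP cycle_id -order_eq1 ox.
  have Px2: x ^+ 2 \in P^# by rewrite !inE defP mem_cycle -order_eq1 ox2.
  have [g _ Kx2] := fusP _ _ Px Px2.
  have nKx2: x ^+ 2 \in 'N(K) by case/setD1P: Px2 => _ /(subsetP nKP).
  have := order_dvdG (expg_order_rcoset nKx2 Kx2).
  by rewrite ox2 -conjXg orderJ ox2 dvdn2 oddK.
have [a [b [Pa Pb Pab uniq4]]] := noncyclic4_generators cardP ncP.
have oP t := @noncyclic4_involution P t cardP ncP.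
have nK t: t \in P^# -> t \in 'N(K) by case/setD1P=> _ /(subsetP nKP).
have inP t: t \in P^# -> t \in P by case/setD1P.
rewrite (sum_mulg_order4 tiKP cardP _ _ uniq4) ?inP //.
have [s Ps le5s] := noncyclic4_fixed5 oddK nKP ncP cardP K5.
(* Fusion carries the index bound k/5 from [s] to every involution of [P], and 6 - 4/5 = 26/5. *)
have le t: t \in P^# -> 26 * #|K| <= 5 * rcoset_orders K t.
  move=> Pt; have := leq_rcoset_orders oddK solK (nK t Pt).
  rewrite oP // => /(_ coK2).
  suff <-: #|K : 'C_K[s]| = #|K : 'C_K[t]| by move: le5s; lia.
  have [g nKg Kt_sg] := fusP s t Ps Pt; rewrite !index_cent1 -(card_class_norm s nKg).
  suff /class_eqP->: s ^ g \in t ^: K by [].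
  by rewrite eq_order_rcoset_class ?nK ?orderJ ?oP.
move: (le a Pa) (le b Pb) (le _ Pab).
have := leq_sum_orders oddK solK; have k_gt0 := cardG_gt0 K.
(* The bounds 3 * 26k/5 and 3k - 2 add up to 93k/5 - 2, which exceeds 91k/5 only for k > 5. At k = 5
   the group [K] is abelian and its stronger bound applies. *)
have [K_5|] := eqVneq #|K| 5; last first.
  by case/dvdnP: K5; lia.
have abK: abelian K by rewrite cyclic_abelian // prime_cyclic // K_5.
by have := sum_orders_abelian abK oddK K5; lia.
Qed.

Lemma sum_orders_solvable_neq G : solvable G -> (60 * sum_orders G <> 211 * #|G|)%N.
Proof.
move=> solG psiG.
have /dvdnP[m cardG]: (60 %| #|G|)%N.
  by rewrite -(@Gauss_dvdr _ 211) // -psiG dvdn_mulr.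
(* For [#|G|] equal to 60m the hypothesis reads [sum_orders G = 211 * m], and this sum is odd. *)
have odd_m: odd m.
  have: sum_orders G = (211 * m)%N by move: psiG; rewrite cardG; lia.
  by move=> psi_m; have := odd_sum_orders G; rewrite psi_m oddM.
have [P sylP] := Sylow_exists 2 G; set K := 'O_2^'(G)%G.
have cardP: #|P| = 4.
  rewrite (card_Hall sylP) cardG (_ : m * 60 = m * 15 * 4)%N; last by lia.
  rewrite partnM ?muln_gt0 ?(odd_gt0 odd_m) // part_p'nat ?mul1n ?part_pnat_id //.
  by rewrite p'natE // dvdn2 oddM odd_m.
have oddK: odd #|K|.
  by have := pcore_pgroup 2^' G; rewrite /pgroup p'natE // dvdn2 negbK.
have nsKG: K <| G := pcore_normal _ _; have nKG := normal_norm nsKG.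
have solK: solvable K := solvableS (normal_sub nsKG) solG.
have nKP: P \subset 'N(K) := subset_trans (pHall_sub sylP) nKG.
have cardKP: #|K * P| = (#|K| * 4)%N.
  rewrite TI_cardMg ?cardP //; apply: coprime_TIg.
  by rewrite cardP; apply: (@coprimeXr 2 _ 2); rewrite coprimen2.
have [defG|[sKPG cardG12 ord3 fusP]] := order4_Sylow_structure solG sylP cardP.
  have K15: (15 %| #|K|)%N.
    have: (15 %| #|K| * 4)%N by rewrite -cardKP defG cardG; apply/dvdnP; exists (m * 4)%N; lia.
    by rewrite Gauss_dvdl.
  have: (211 * #|K| < 15 * \sum_(u in (K * P)%g) #[u])%N.
    have [cP|ncP] := boolP (cyclic P); first exact: sum_orders_cyclic4.
    exact: sum_orders_noncyclic4.
  rewrite defG -/(sum_orders G).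
  by have := cardKP; rewrite defG; lia.
have K5: (5 %| #|K|)%N.
  have: (5 %| 12 * #|K|)%N by rewrite -cardG12 cardG; apply/dvdnP; exists (m * 12)%N; lia.
  by rewrite Gauss_dvdr.
pose M := K * P; have sMG: M \subset G by [].
have: 91 * #|K| < 5 * \sum_(u in M) #[u].
  apply: sum_orders_fused4 => // s t Ps Pt.
  by have [g Gg Kg] := fusP s t Ps Pt; exists g => //; apply: (subsetP nKG).
have: #|G :\: M| * 3 <= \sum_(u in G :\: M) #[u].
  by rewrite -sum_nat_const; apply: leq_sum => u /ord3.
move: psiG; rewrite /sum_orders (big_setID M) /= (setIidPr sMG).
rewrite cardsD (setIidPr sMG) cardKP cardG12.
set s1 := \sum_(u in M) _; set s2 := \sum_(u in _ :\: _) _.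
rewrite -[#|K|]/#|'O_2^'(G)|; set k := #|'O_2^'(G)|; lia.
Qed.

End NormalTwoComplement.

Theorem theorem1p1 (gT : finGroupType) (G : {group gT}) (solG : solvable G) :
  average_order G <> 211%:R / 60%:R.
Proof.
move=> avgG; apply: (sum_orders_solvable_neq solG).
move: avgG; rewrite /average_order => /eqP.
rewrite eqr_div ?Num.Theory.pnatr_eq0 -?lt0n ?cardG_gt0 //.
by rewrite -!natrM Num.Theory.eqr_nat mulnC => /eqP.
Qed.
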